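(* Let $X = \ell_1^{(n)}$ (real) and let $F \subset X$ be a convex bounded set with non-empty interior in $X$. Then the following are equivalent: (a) $F$ is an existence set; (b) $F$ is a contractive set; (c) $F$ is the intersection of a countable number of contractive half-spaces.
   Context: $\ell_1^{(n)}$ is $\mathbb{R}^n$ with the norm $\|x\| = \sum_{j=1}^n |x_j|$. For a non-empty set $F \subset X$ and $x \in X$, let $R_F(x) = \{ d \in F : \|d-c\| \le \|x-c\| \text{ for all } c \in F\}$; $F$ is an existence set if $R_F(x) \neq \emptyset$ for every $x \in X$. A non-empty set $D \subset X$ is contractive if there exists $P : X \to D$ with $P|_D = \mathrm{id}_D$ and $\|Px - Py\| \le \|x-y\|$ for all $x,y \in X$. A half-space is a set $\{x : f(x) \le d\}$ with $f \in X^*\setminus\{0\}$, $d \in \mathbb{R}$; a contractive half-space is a half-space which is a contractive set. *)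

(* Defs.v *)
From HB Require Import structures.
From mathcomp Require Import all_boot all_order all_algebra.
From mathcomp Require Import reals.
Set Implicit Arguments. Unset Strict Implicit. Unset Printing Implicit Defensive.
Import Order.TTheory GRing.Theory Num.Theory.
Local Open Scope ring_scope.

Section L1.
Variables (R : realType) (n : nat).
Notation X := 'rV[R]_n.

Definition l1norm (x : X) : R := \sum_(i < n) `|x ord0 i|.

(* linear functionals on R^n (all are continuous, since dim X < oo): X^* *)
Definition lin_functional (f : X -> R) : Prop :=
  forall (a : R) (x y : X), f (a *: x + y) = a * f x + f y.

Definition RF (F : X -> Prop) (x : X) (d : X) : Prop :=
  F d /\ forall c : X, F c -> l1norm (d - c) <= l1norm (x - c).

Definition existence_set (F : X -> Prop) : Prop :=
  forall x : X, exists d : X, RF F x d.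

Definition contractive_set (D : X -> Prop) : Prop :=
  (exists x0 : X, D x0) /\
  exists P : X -> X,
    (forall x : X, D (P x)) /\
    (forall x : X, D x -> P x = x) /\
    (forall x y : X, l1norm (P x - P y) <= l1norm (x - y)).

Definition half_space (H : X -> Prop) : Prop :=
  exists (f : X -> R) (d : R),
    lin_functional f /\ (exists x : X, f x != 0) /\
    forall x : X, H x <-> f x <= d.

Definition contractive_half_space (H : X -> Prop) : Prop :=
  half_space H /\ contractive_set H.

Definition convex_set (F : X -> Prop) : Prop :=
  forall (x y : X) (t : R), F x -> F y -> 0 <= t -> t <= 1 ->
    F (t *: x + (1 - t) *: y).

Definition bounded_set (F : X -> Prop) : Prop :=
  exists M : R, forall x : X, F x -> l1norm x <= M.

Definition nonempty_interior (F : X -> Prop) : Prop :=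
  exists (x0 : X) (r : R), 0 < r /\
    forall y : X, l1norm (y - x0) < r -> F y.

(* F is the intersection of countably many contractive half-spaces
   (a nonempty finite family is covered by repeating members). *)
Definition countable_inter_contractive_half_spaces (F : X -> Prop) : Prop :=
  exists H : nat -> X -> Prop,
    (forall k, contractive_half_space (H k)) /\
    forall x : X, F x <-> (forall k, H k x).
End L1.

(* Main.v *)
From mathcomp Require Import all_boot all_order all_algebra reals.
From mathcomp Require Import boolp classical_sets topology normedtype.
From mathcomp Require Import ring lra.
Require Import Defs.
Set Implicit Arguments. Unset Strict Implicit. Unset Printing Implicit Defensive.
Import Order.TTheory GRing.Theory Num.Theory numFieldNormedType.Exports.
Local Open Scope ring_scope.

(* Call F two-coordinate separated if every point outside F is strictly
   separated from F by a functional of the form a x_i + b x_j; all three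
   conditions are equivalent to it.
   - An existence set has at most two nonzero coordinates in its normal vector at
     any point where it is touched from inside by a Euclidean ball.  The contact
     points of small balls give enough supporting half-spaces to cut out F, and
     the same fact applies to a contractive half-space itself.
   - Perturbing the coefficients to rationals leaves countably many half-spaces.
   - Conversely, for i, j and signs s1, s2, moving x along - (s1 e_i + s2 e_j) until
     it lies in the closure of F + {y : s1 y_i <= 0, s2 y_j <= 0} is a nonexpansive
     map fixing F.  A suitable composition T of such maps has F as
     its fixed point set and strictly decreases the distance to some point of F
     at every point it moves, so the iterates of T converge to a nonexpansive
     retraction onto F.  This also shows that the half-spaces found are
     contractive. *)

(** * The l1 norm and cluster points of bounded sequences *)

Section Norm.
Variables (R : realType) (n : nat).
Implicit Types x y z : 'rV[R]_n.

Lemma l1norm_ge0 x : 0 <= l1norm x.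
Proof. by apply: sumr_ge0 => i _; rewrite normr_ge0. Qed.

Lemma l1norm0 : l1norm (0 : 'rV[R]_n) = 0.
Proof. by apply: big1 => i _; rewrite mxE normr0. Qed.

Lemma l1normD x y : l1norm (x + y) <= l1norm x + l1norm y.
Proof.
rewrite /l1norm -big_split /=; apply: ler_sum => i _.
by rewrite mxE ler_normD.
Qed.

Lemma l1normZ (a : R) x : l1norm (a *: x) = `|a| * l1norm x.
Proof.
by rewrite /l1norm mulr_sumr; apply: eq_bigr => i _; rewrite mxE normrM.
Qed.

Lemma l1normN x : l1norm (- x) = l1norm x.
Proof. by rewrite -scaleN1r l1normZ normrN1 mul1r. Qed.

Lemma l1distC x y : l1norm (x - y) = l1norm (y - x).
Proof. by rewrite -l1normN opprB. Qed.

Lemma l1dist_triangle y x z : l1norm (x - z) <= l1norm (x - y) + l1norm (y - z).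
Proof. by rewrite -[x - z](subrKA y) l1normD. Qed.

Lemma coord_le_l1norm x i : `|x ord0 i| <= l1norm x.
Proof. by rewrite /l1norm (bigD1 i) //= lerDl sumr_ge0. Qed.

Lemma l1norm_eq0 x : l1norm x <= 0 -> x = 0.
Proof.
move=> x0; apply/rowP => i; rewrite mxE; apply/eqP.
by rewrite -normr_le0; apply: le_trans x0; exact: coord_le_l1norm.
Qed.

Lemma l1norm_le (e : R) x : (forall i, `|x ord0 i| <= e) -> l1norm x <= n%:R * e.
Proof.
move=> xe; rewrite -[n in n%:R]card_ord -sum1_card natr_sum mulr_suml.
by apply: ler_sum => i _; rewrite mul1r.
Qed.

Lemma l1norm_delta (i : 'I_n) (d : R) : l1norm (d *: delta_mx ord0 i) = `|d|.
Proof.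
rewrite l1normZ /l1norm (bigD1 i) //= big1 => [|j ji].
  by rewrite mxE !eqxx normr1 addr0 mulr1.
by rewrite mxE (negPf ji) andbF normr0.
Qed.

Lemma bounded_cluster (u : nat -> 'rV[R]_n) (M : R) :
  (forall k, l1norm (u k) <= M) ->
  exists z, forall e, 0 < e -> forall N, exists2 k,
    (N <= k)%N & l1norm (u k - z) < e.
Proof.
move=> uM.
have K : compact [set v : 'rV[R]_n | forall i, `[- M, M]%classic (v ord0 i)].
  by apply: (@rV_compact _ _ (fun=> `[- M, M]%classic)) => i; exact: segment_compact.
have [] := K (u @ \oo)%classic _.
  exists 0%N => // k _ i /=; rewrite in_itv /=.
  by rewrite -ler_norml; apply: le_trans (uM k); exact: coord_le_l1norm.
move=> z [_ zcl]; exists z => e e0 N.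
have en : 0 < e / n.+1%:R by rewrite divr_gt0.
have [] := zcl (fun v => exists2 k, (N <= k)%N & v = u k) (ball z (e / n.+1%:R)).
- by exists N => // k Nk; exists k.
- exact: nbhsx_ballx.
move=> _ [[k Nk ->]] [_ zb]; exists k => //; rewrite l1distC.
apply: (@le_lt_trans _ _ (n%:R * (e / n.+1%:R))).
  by apply: l1norm_le => i; rewrite !mxE; apply/ltW; exact: zb.
by rewrite mulrA ltr_pdivrMr // [ltRHS]mulrC ltr_pM2r ?ltr_nat.
Qed.

End Norm.

(** * Normal vectors at points touched from inside by a Euclidean ball *)

Section Touching.
Variables (R : realType) (n : nat).
Implicit Types x y z v w : 'rV[R]_n.

Definition dot x y : R := \sum_(i < n) x ord0 i * y ord0 i.

Lemma dotC x y : dot x y = dot y x.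
Proof. by apply: eq_bigr => i _; rewrite mulrC. Qed.

Lemma dotDr x y z : dot x (y + z) = dot x y + dot x z.
Proof.
by rewrite /dot -big_split; apply: eq_bigr => i _; rewrite mxE mulrDr.
Qed.

Lemma dotZr (a : R) x y : dot x (a *: y) = a * dot x y.
Proof.
by rewrite /dot mulr_sumr; apply: eq_bigr => i _; rewrite mxE mulrCA.
Qed.

Lemma dotNr x y : dot x (- y) = - dot x y.
Proof. by rewrite -scaleN1r dotZr mulN1r. Qed.

Lemma dotDl x y z : dot (y + z) x = dot y x + dot z x.
Proof. by rewrite dotC dotDr !(dotC x). Qed.

Lemma dotZl (a : R) x y : dot (a *: y) x = a * dot y x.
Proof. by rewrite dotC dotZr dotC. Qed.

Lemma dotNl x y : dot (- y) x = - dot y x.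
Proof. by rewrite dotC dotNr dotC. Qed.

Definition dotE := (dotDr, dotDl, dotNr, dotNl, dotZr, dotZl).

Lemma dot_ge0 x : 0 <= dot x x.
Proof. by apply: sumr_ge0 => i _; rewrite -expr2 sqr_ge0. Qed.

Lemma dot_gt0 x : x != 0 -> 0 < dot x x.
Proof.
move=> x0; rewrite lt_neqAle dot_ge0 andbT eq_sym; apply: contra x0.
rewrite /dot psumr_eq0 => [/allP x0|i _]; last by rewrite -expr2 sqr_ge0.
apply/eqP/rowP => i; rewrite mxE; apply/eqP.
by have := x0 i (mem_index_enum i); rewrite mulf_eq0 orbb.
Qed.

Lemma dot_le_l1norm x y : dot x y <= l1norm x * l1norm y.
Proof.
rewrite /dot {1}/l1norm mulr_suml; apply: ler_sum => i _.
apply: (le_trans (ler_norm _)); rewrite normrM.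
by rewrite ler_wpM2l ?coord_le_l1norm.
Qed.

(* A step of l1-length O(e) from z + e v back into G must not increase the
   distance to the points of the ball.  Those points realise, for every i in the
   support of v, all sign patterns of the other coordinates, which forces the
   i-th coordinate of the step to carry at least half of its l1-length. *)
Lemma touching_normal_support (G : 'rV[R]_n -> Prop) z v (i j k : 'I_n) :
  existence_set G -> (forall c, G c -> dot v c <= dot v z) ->
  (forall b, dot (b - (z - v)) (b - (z - v)) <= dot v v -> G b) ->
  i != j -> i != k -> j != k ->
  v ord0 i * v ord0 j * v ord0 k = 0.
Proof.
move=> exG supp ballG ij ik jk.
have [//|] := eqVneq (v ord0 i * v ord0 j * v ord0 k) 0.
rewrite !mulf_eq0 !negb_or => /andP[/andP[vi vj] vk].
set L := l1norm v; set V := dot v v.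
have L0 : 0 <= L by exact: l1norm_ge0.
have V0 : 0 < V.
  by apply: dot_gt0; apply: contraNneq vi => ->; rewrite mxE.
(* [A * |v_l| >= L + 1] wherever [v_l != 0]: one entry of size [A] outweighs all other entries of
   size 1. *)
set A := 1 + \sum_l (L + 1) / `|v ord0 l|.
have S0 (P : pred 'I_n) : 0 <= \sum_(l | P l) (L + 1) / `|v ord0 l|.
  by apply: sumr_ge0 => l _; rewrite divr_ge0 ?addr_ge0.
have A1 : 1 <= A by rewrite lerDl.
have Av l : v ord0 l != 0 -> L + 1 <= A * `|v ord0 l|.
  move=> vl; rewrite -ler_pdivrMr ?normr_gt0 // /A (bigD1 l) //=.
  by have := S0 (predC1 l); lra.
have n0 : 1 <= n%:R :> R by rewrite ler1n; exact: leq_ltn_trans (ltn_ord i).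
(* Makes [n (h A)^2 = h], so a vector with entries at most [h A] has squared length at most [h]. *)
set h := (n%:R * A ^+ 2)^-1.
have hE : n%:R * (h * A) ^+ 2 = h.
  rewrite /h; field; rewrite -?[1 + _]/A; apply/andP; split; lra.
have h0 : 0 < h by rewrite invr_gt0 mulr_gt0 ?exprn_gt0; lra.
have h1 : h <= 1 by rewrite invf_le1; nra.
(* Then [3 e V <= h], which absorbs the growth of [(1 + e)^2 V] when [x - y] is shown to lie in the
   ball. *)
set e := h / (3 * V + 1).
have e0 : 0 < e by rewrite divr_gt0 //; lra.
have eE : e * (3 * V + 1) = h by rewrite /e; field; lra.
have e1 : e <= 1 by nra.
set x := z + e *: v.
have [d [Gd dP]] := exG x.
have [w dE] : exists w, d = x - w by exists (x - d); rewrite subKr.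
have vw : e * V <= dot v w.
  by have := supp _ Gd; rewrite dE /x !dotE -/V; lra.
have half l : v ord0 l != 0 -> l1norm w <= 2 * `|w ord0 l|.
  move=> vl.
  (* Off [l] the signs oppose those of [w], so [|y_m - w_m| = |y_m| + |w_m|]; the entry at [l] keeps
     [x - y] in the ball. Then [|y - w| <= |y|] bounds the rest of [w] by [|w_l|]. *)
  pose s m : R := if m == l then A * Num.sg (v ord0 l)
                  else if 0 <= w ord0 m then -1 else 1.
  pose y : 'rV[R]_n := \row_m (h * s m).
  have sA m : `|s m| <= A.
    rewrite /s; case: ifP => _; last by case: ifP; rewrite ?normrN1 ?normr1.
    by rewrite normrM normr_sg vl mulr1 ger0_norm //; lra.
  have vy : h <= dot v y.
    rewrite /dot (bigD1 l) //= mxE {1}/s eqxx mulrCA.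
    have -> : v ord0 l * (A * Num.sg (v ord0 l)) = A * `|v ord0 l|.
      by rewrite normrEsg; ring.
    have : - (h * \sum_(m | m != l) `|v ord0 m|)
        <= \sum_(m | m != l) v ord0 m * y ord0 m.
      rewrite mulr_sumr -sumrN; apply: ler_sum => m ml.
      rewrite mxE /s (negPf ml) lerNl -!mulrN mulrCA ler_wpM2l ?(ltW h0) //.
      by case: (0 <= w ord0 m); rewrite ?opprK ?mulr1 ?ler_norm // mulrN1 -normrN ler_norm.
    have : L = `|v ord0 l| + \sum_(m | m != l) `|v ord0 m|.
      by rewrite /L /l1norm (bigD1 l).
    have := Av l vl; have := normr_ge0 (v ord0 l); nra.
  have yy : dot y y <= h.
    rewrite -hE -[n in n%:R]card_ord -sum1_card natr_sum mulr_suml.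
    apply: ler_sum => m _; rewrite mul1r mxE -expr2 !exprMn.
    rewrite ler_wpM2l ?sqr_ge0 // -real_normK ?num_real //.
    by rewrite lerXn2r ?nnegrE //; lra.
  have Gxy : G (x - y).
    apply: ballG; have -> : x - y - (z - v) = (1 + e) *: v - y.
      by apply/rowP => m; rewrite !mxE; ring.
    by rewrite !dotE (dotC y v) -/V; nra.
  have := dP _ Gxy.
  have -> : d - (x - y) = y - w by apply/rowP => m; rewrite dE !mxE; ring.
  rewrite subKr /l1norm (bigD1 l) //= [X in _ <= X -> _](bigD1 l) //=.
  rewrite [X in _ -> X <= _](bigD1 l) //=.
  have : \sum_(m | m != l) (`|y ord0 m| + `|w ord0 m|)
      <= \sum_(m | m != l) `|(y - w) ord0 m|.
    apply: ler_sum => m ml; rewrite !mxE /s (negPf ml).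
    case: (lerP 0 (w ord0 m)) => wm.
      by rewrite mulrN1 normrN -opprD normrN ger0_norm ?(ltW h0) // !ger0_norm ?addr_ge0 ?(ltW h0).
    by rewrite mulr1 (gtr0_norm h0) ltr0_norm // gtr0_norm //; lra.
  rewrite big_split /=.
  have : `|y ord0 l| - `|w ord0 l| <= `|(y - w) ord0 l|.
    by rewrite !mxE lerB_dist.
  lra.
(* Three coordinates, each carrying half of the norm of [w], force [w = 0], contrary to [vw]. *)
have : `|w ord0 i| + `|w ord0 j| + `|w ord0 k| <= l1norm w.
  rewrite /l1norm (bigD1 i) //= (bigD1 j) 1?eq_sym //= (bigD1 k) /=; last first.
    by rewrite eq_sym ik eq_sym.
  by rewrite !addrA lerDl sumr_ge0.
have := half _ vi; have := half _ vj; have := half _ vk => hk hj hi hs.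
have w0 : w = 0 by apply: l1norm_eq0; lra.
move: vw; rewrite w0 /dot big1 => [|m _]; last by rewrite mxE mulr0.
by rewrite leNgt mulr_gt0.
Qed.

Lemma dot_two_coords v (n0 : (0 < n)%N) :
  (forall i j k : 'I_n, i != j -> i != k -> j != k ->
    v ord0 i * v ord0 j * v ord0 k = 0) ->
  exists i j (a b : R), forall x, dot v x = a * x ord0 i + b * x ord0 j.
Proof.
move=> three.
have [[i vi]|v0] := pselect (exists i, v ord0 i != 0); last first.
  exists (Ordinal n0), (Ordinal n0), 0, 0 => x; rewrite !mul0r addr0.
  by apply: big1 => i _; have [->|vi] := eqVneq (v ord0 i) 0;
    rewrite ?mul0r //; case: v0; exists i.
have [[j ji vj]|vi0] := pselect (exists2 j, j != i & v ord0 j != 0); last first.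
  exists i, i, (v ord0 i), 0 => x; rewrite mul0r /dot (bigD1 i) //= big1 // => j ji.
  by have [->|vj] := eqVneq (v ord0 j) 0; rewrite ?mul0r //; case: vi0; exists j.
exists i, j, (v ord0 i), (v ord0 j) => x.
rewrite /dot (bigD1 i) //= (bigD1 j) //= big1 ?addr0 // => k /andP[ki kj].
have ij : i != j by rewrite eq_sym.
have ik : i != k by rewrite eq_sym.
have jk : j != k by rewrite eq_sym.
have /eqP := three i j k ij ik jk.
by rewrite !mulf_eq0 (negPf vi) (negPf vj) /= => /eqP->; rewrite mul0r.
Qed.

End Touching.

(** * From existence sets to separation by two coordinates *)

Section Separation.
Variables (R : realType) (n : nat).
Implicit Types (x y z p q h g : 'rV[R]_n) (F : 'rV[R]_n -> Prop).

Definition two_coord_separated F := forall x, ~ F x ->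
  exists i j (a b t : R),
    (forall c, F c -> a * c ord0 i + b * c ord0 j <= t) /\
    t < a * x ord0 i + b * x ord0 j.

(** If [c] in [F] is close to [x], then so is any [d] in [RF F x], being no farther from [c] than
    [x] is; hence [d = x]. *)
Lemma existence_set_closed F x : existence_set F ->
  (forall e, 0 < e -> exists2 c, F c & l1norm (x - c) < e) -> F x.
Proof.
move=> exF xF; have [d [Fd dP]] := exF x.
suff /l1norm_eq0/subr0_eq-> : l1norm (x - d) <= 0 by [].
apply/ler_addgt0Pr => e e0; have [|c Fc xc] := xF (e / 2); first by lra.
have := l1dist_triangle c x d; have := dP _ Fc.
by rewrite (l1distC d); lra.
Qed.

Lemma dot_ball_near (t : R) h : dot h h < t ->
  exists2 e, 0 < e & forall g, l1norm g < e -> dot (h + g) (h + g) <= t.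
Proof.
move=> ht; have H0 := l1norm_ge0 h; set d := (t - dot h h) / (2 * l1norm h + 1).
have d0 : 0 < d by rewrite divr_gt0 //; lra.
have dE : d * (2 * l1norm h + 1) = t - dot h h by rewrite /d; field; lra.
exists (Num.min 1 d) => [|g]; rewrite lt_min ?ltr01 // => /andP[g1 gd].
have := dot_le_l1norm h g; have := dot_le_l1norm g g; have := l1norm_ge0 g.
by rewrite !dotE (dotC g h); nra.
Qed.

Lemma l1norm_le_dot (e : R) g : 0 <= e -> dot g g <= e ^+ 2 ->
  l1norm g <= n%:R * e.
Proof.
move=> e0 ge; apply: l1norm_le => i; rewrite -(@ler_pXn2r _ 2) ?nnegrE //.
apply: le_trans ge; rewrite real_normK ?num_real // expr2 /dot (bigD1 i) //=.
by rewrite lerDl sumr_ge0 // => j _; rewrite -expr2 sqr_ge0.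
Qed.

(** A point [y] of [F] beyond the tangent plane would put [z] in the interior of the convex hull of
    [y] and the ball, while points outside [F] come arbitrarily close to [z]. *)
Lemma convex_inner_ball_support F q z (t : R) : convex_set F ->
  (forall b, dot (b - q) (b - q) <= t -> F b) ->
  dot (z - q) (z - q) <= t ->
  (forall e, 0 < e -> exists2 y, ~ F y & l1norm (y - z) < e) ->
  dot (z - q) (z - q) = t /\ forall y, F y -> dot (z - q) y <= dot (z - q) z.
Proof.
move=> cF ballF zt zout; set v := z - q.
have ge y (k : R) : F y -> 0 <= k -> t <= dot (v - k *: (y - z)) (v - k *: (y - z)).
  move=> Fy k0; rewrite leNgt; apply/negP => /dot_ball_near[e e0 near].
  have [|y' nFy' y'z] := zout (e / (1 + k)); first by rewrite divr_gt0 //; lra.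
  apply: nFy'; have -> : y' = (1 + k)^-1 *: ((1 + k) *: y' - k *: y)
      + (1 - (1 + k)^-1) *: y.
    by apply/rowP => i; rewrite !mxE; field; lra.
  have k1 : 0 < (1 + k)^-1 by rewrite invr_gt0; lra.
  apply: cF => //; last by rewrite invf_le1; lra.
  - apply: ballF; have -> : (1 + k) *: y' - k *: y - q
        = v - k *: (y - z) + (1 + k) *: (y' - z).
      by apply/rowP => i; rewrite /v !mxE; ring.
    apply: near; rewrite l1normZ ger0_norm; last by lra.
    by rewrite mulrC -ltr_pdivlMr //; lra.
  - exact: ltW.
split.
  apply/eqP; rewrite eq_le zt /=.
  by have := ge z 0 (ballF _ zt) (lexx _); rewrite scale0r subr0.
move=> y Fy; rewrite leNgt; apply/negP => vy.
set s := dot (y - z) (y - z); set a := dot v (y - z).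
have s0 : 0 <= s by exact: dot_ge0.
have a0 : 0 < a by rewrite /a dotDr dotNr; lra.
set k := a / (s + 1).
have kE : k * (s + 1) = a by rewrite /k; field; lra.
have k0 : 0 < k by rewrite divr_gt0 //; lra.
have := ge y k Fy (ltW k0).
rewrite dotDr dotDl dotDl !dotNl !dotNr !dotZl !dotZr (dotC (y - z) v) -/s -/a.
nra.
Qed.

(* For a small radius r, slide a Euclidean ball of radius r from an interior
   point p of F towards x until it touches the complement of F.  The common
   tangent hyperplane at the contact point separates x from F. *)
Lemma existence_two_coord_separated F : (0 < n)%N -> convex_set F ->
  nonempty_interior F -> existence_set F -> two_coord_separated F.
Proof.
move=> n0 cF [p [rho1 [rho10 pF]]] exF x nFx.
have clF := existence_set_closed exF.
pose rho : R := rho1 / n.+1%:R.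
have rho0 : 0 < rho by rewrite divr_gt0.
have ballp y : dot (y - p) (y - p) <= rho ^+ 2 -> F y.
  move=> /(l1norm_le_dot (ltW rho0)) yp; apply: pF; apply: (le_lt_trans yp).
  by rewrite /rho mulrA ltr_pdivrMr // mulrC ltr_pM2l // ltr_nat.
have Fp : F p.
  by apply: ballp; rewrite subrr -(scale0r 0) dotZl mul0r sqr_ge0.
have [d d0 dF] : exists2 d, 0 < d & forall c, F c -> d <= l1norm (x - c).
  apply: contrapT => nd; apply/nFx/clF => e e0; apply: contrapT => ne.
  apply: nd; exists e => // c Fc; rewrite leNgt; apply/negP => xc.
  by apply: ne; exists c.
set D := x - p; have Dd : d <= l1norm D by exact: dF.
set d' := d / l1norm D.
have d'E : d' * l1norm D = d by rewrite /d'; field; lra.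
have d'0 : 0 < d' by rewrite divr_gt0 //; lra.
have d'1 : d' <= 1 by nra.
pose r := d' * rho / 4; have r0 : 0 < r by rewrite /r; nra.
have rrho : r <= rho by rewrite /r; nra.
pose q s := p + s *: D.
pose S : set R := [set s | 0 <= s /\
  forall b, dot (b - q s) (b - q s) <= r ^+ 2 -> F b]%classic.
have dot0 : dot (0 : 'rV[R]_n) 0 = 0 by rewrite -(scale0r 0) dotZl mul0r.
have S0 : S 0.
  split=> // b; rewrite /q scale0r addr0 => br; apply: ballp.
  by apply: (le_trans br); rewrite lerXn2r // nnegrE ltW.
have Sub s : S s -> s <= 1 - d'.
  move=> [s0 sF].
  have Fq : F (q s) by apply: sF; rewrite subrr dot0 sqr_ge0.
  have [s1|s1] := ltP s 1.
    have := dF _ Fq; have -> : x - q s = (1 - s) *: D.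
      by apply/rowP => i; rewrite /q /D !mxE; ring.
    by rewrite l1normZ ger0_norm; nra.
  case: nFx; have -> : x = s^-1 *: q s + (1 - s^-1) *: p.
    by apply/rowP => i; rewrite /q /D !mxE; field; lra.
  by apply: cF; rewrite ?invr_ge0 ?invf_le1 //; lra.
have supS : has_sup S by split; [exists 0 | exists (1 - d') => s /Sub].
pose sg := sup S.
have sg0 : 0 <= sg by apply: sup_upper_bound.
have sg1 : sg <= 1 - d' by apply: ge_sup; [exists 0 | exact: Sub].
have ballq b : dot (b - q sg) (b - q sg) <= r ^+ 2 -> F b.
  move=> bq; apply: clF => e e0.
  have D0 := l1norm_ge0 D.
  have eD : 0 < e / (l1norm D + 1) by rewrite divr_gt0 //; lra.
  have [s Ss ssg] := sup_adherent eD supS.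
  have les : s <= sg by apply: sup_upper_bound.
  exists (b - (sg - s) *: D).
    apply: (proj2 Ss); suff -> : b - (sg - s) *: D - q s = b - q sg by [].
    by apply/rowP => i; rewrite /q !mxE; ring.
  rewrite subKr l1normZ ger0_norm ?subr_ge0 //.
  have : (sg - s) * (l1norm D + 1) < e by rewrite -ltr_pdivlMr -/sg in ssg *; lra.
  nra.
(* The ball moved by [1/(k+1)] past the supremum leaves [F]; the witnesses [w] in the last ball
   cluster at the contact point [z]. *)
have Sout k : exists w, dot (w - q sg) (w - q sg) <= r ^+ 2 /\
    ~ F (w + k.+1%:R^-1 *: D).
  apply: contrapT => nk; have k0 : 0 < k.+1%:R^-1 :> R by rewrite invr_gt0.
  have : S (sg + k.+1%:R^-1).
    split=> [|b bq]; first by rewrite addr_ge0 // ltW.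
    apply: contrapT => nFb; apply: nk; exists (b - k.+1%:R^-1 *: D).
    rewrite subrK; split=> //; suff -> : b - k.+1%:R^-1 *: D - q sg
      = b - q (sg + k.+1%:R^-1) by [].
    by apply/rowP => i; rewrite /q !mxE; ring.
  by move=> /(sup_upper_bound supS); rewrite -/sg gerDl leNgt k0.
have [u uP] := choice Sout.
have [z zP] : exists z, forall e, 0 < e -> forall N, exists2 k,
    (N <= k)%N & l1norm (u k - z) < e.
  apply: (@bounded_cluster _ _ _ (n%:R * r + l1norm (q sg))) => k.
  rewrite -[u k](subrK (q sg)); apply: (le_trans (l1normD _ _)).
  by rewrite lerD2r; apply: l1norm_le_dot (ltW r0) (proj1 (uP k)).
have zq : dot (z - q sg) (z - q sg) <= r ^+ 2.
  rewrite leNgt; apply/negP => zr; set h := z - q sg in zr.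
  have H0 := l1norm_ge0 h.
  set e := (dot h h - r ^+ 2) / (2 * l1norm h + 1).
  have e0 : 0 < e by rewrite divr_gt0 //; lra.
  have eE : e * (2 * l1norm h + 1) = dot h h - r ^+ 2 by rewrite /e; field; lra.
  have [k _ kz] := zP e e0 0%N; have [+ _] := uP k.
  set g := u k - z in kz; have -> : u k - q sg = h + g.
    by rewrite /h /g [RHS]addrC subrKA.
  clearbody h g; have := dot_le_l1norm h (- g); have := dot_ge0 g; have := l1norm_ge0 g.
  by rewrite !dotE l1normN (dotC g h); nra.
have zout e : 0 < e -> exists2 y, ~ F y & l1norm (y - z) < e.
  move=> e0; have D0 := l1norm_ge0 D.
  have e2 : 0 < e / 2 by lra.
  have [k Nk kz] := zP _ e2 (Num.bound (2 * l1norm D / e)).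
  exists (u k + k.+1%:R^-1 *: D); first exact: (proj2 (uP k)).
  rewrite addrAC; apply: (le_lt_trans (l1normD _ _)).
  rewrite l1normZ ger0_norm ?invr_ge0 //.
  rewrite [ltRHS]splitr ltrD // mulrC ltr_pdivrMr // -ltr_pdivrMl //.
  have : 2 * l1norm D / e < (Num.bound (2 * l1norm D / e))%:R.
    by apply: archi_boundP; rewrite divr_ge0 ?(ltW e0) //; lra.
  have : (Num.bound (2 * l1norm D / e))%:R <= k.+1%:R :> R.
    by rewrite ler_nat ltnW.
  have -> : (e / 2)^-1 * l1norm D = 2 * l1norm D / e by field; lra.
  lra.
have [vv supp] := convex_inner_ball_support cF ballq zq zout.
set v := z - q sg in vv supp.
have [i [j [a [b vE]]]] : exists i j (a b : R),
    forall y, dot v y = a * y ord0 i + b * y ord0 j.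
  apply: dot_two_coords => // i j k; apply: touching_normal_support exF supp _.
  by move=> y; rewrite subKr vv; exact: ballq.
exists i, j, a, b, (dot v z); split=> [c /supp|]; first by rewrite vE.
(* The ball of radius [rho] about [p] lies below the tangent plane, so [rho * r <= sg * m + r^2]
   with [m = dot v D]. By [r = d' * rho / 4] and [d' <= 1 - sg], this yields
   [(1 - sg) * m >= 3 r^2 > r^2], so [x] lies strictly above. *)
rewrite -vE; have : dot v (p + (rho / r) *: v) <= dot v z.
  apply/supp/ballp; rewrite addrC addKr dotZl dotZr vv le_eqVlt.
  by apply/orP; left; apply/eqP; field; lra.
have zE : z = p + sg *: D + v by rewrite addrC subrK.
have xE : x = p + D by rewrite addrC subrK.
clearbody v D; rewrite {}zE xE.
rewrite !dotDr !dotZr vv; have -> : rho / r * r ^+ 2 = rho * r by field; lra.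
set m := dot v D => le1.
have rE : r * 4 = d' * rho by rewrite /r; field.
have rr : 0 < rho * r by rewrite mulr_gt0.
have r2 : r * r * 4 = d' * (rho * r) by rewrite [RHS]mulrA -rE; ring.
have le2 : 3 * (rho * r) <= 4 * (sg * m).
  have : d' * (rho * r) <= rho * r by rewrite ler_piMl // ltW.
  by move: le1; rewrite expr2; lra.
have m0 : 0 < m.
  have : 0 < sg * m by lra.
  move=> /[dup] /lt0r_neq0; rewrite mulf_eq0 negb_or => /andP[s0 _].
  by rewrite pmulr_rgt0 // lt_neqAle eq_sym s0.
have le3 : 3 * (rho * r) <= 4 * m.
  by apply: (le_trans le2); rewrite ler_pM2l // ler_piMl ?(ltW m0) //; lra.
have : d' * (3 * (rho * r)) <= d' * (4 * m) by rewrite ler_pM2l.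
have : d' * m <= (1 - sg) * m by rewrite ler_pM2r //; lra.
by have := mulr_gt0 r0 r0; rewrite expr2; lra.
Qed.

End Separation.

(** * Retractions as limits of iterated nonexpansive maps *)

Section Retraction.
Variables (R : realType) (n : nat) (F : 'rV[R]_n -> Prop).
Implicit Types (x y z c : 'rV[R]_n) (T Q : 'rV[R]_n -> 'rV[R]_n).

Definition nonexpansive_fixing T :=
  (forall x y, l1norm (T x - T y) <= l1norm (x - y)) /\
  forall c, F c -> T c = c.

Definition stalls T z := forall c, F c -> l1norm (z - c) <= l1norm (T z - c).

(** The second clause is the contrapositive of: a point moved by [T] comes strictly closer to some
    point of [F]. *)
Definition strict_toward T :=
  nonexpansive_fixing T /\ forall z, stalls T z -> T z = z.

Lemma nonexpansive_fixing_dist T z c : nonexpansive_fixing T -> F c ->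
  l1norm (T z - c) <= l1norm (z - c).
Proof. by case=> Tn Tf Fc; rewrite -{1}(Tf c). Qed.

(** If [Q \o T] stalls at [z], so does [T], because [Q] increases no distance to [F]; thus
    [T z = z], and [Q] need only be tested at fixed points of [T]. *)
Lemma strict_toward_comp T Q : strict_toward T -> nonexpansive_fixing Q ->
  (forall z, T z = z -> stalls Q z -> Q z = z) ->
  strict_toward (Q \o T) /\ forall z, Q (T z) = z -> T z = z /\ Q z = z.
Proof.
move=> [Tnf Tst] Qnf Qst.
have TQ z c : F c -> l1norm (Q (T z) - c) <= l1norm (T z - c).
  exact: nonexpansive_fixing_dist.
split; first split; first split.
- by move=> x y; apply: le_trans (proj1 Qnf _ _) (proj1 Tnf _ _).
- by move=> c Fc /=; rewrite (proj2 Tnf) // (proj2 Qnf).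
- move=> z zst; have Tz : T z = z.
    by apply: Tst => c Fc; apply: le_trans (zst c Fc) (TQ z c Fc).
  by rewrite /= Tz; apply: Qst => // c Fc; have := zst c Fc; rewrite /= Tz.
move=> z QTz; have Tz : T z = z.
  by apply: Tst => c Fc; rewrite -{1}QTz; exact: TQ.
by split=> //; rewrite -{1}Tz.
Qed.

Lemma strict_toward_seq (I : eqType) (Q : I -> 'rV[R]_n -> 'rV[R]_n) T (s : seq I) :
  strict_toward T ->
  (forall k, k \in s -> nonexpansive_fixing (Q k) /\
    forall z, T z = z -> stalls (Q k) z -> Q k z = z) ->
  exists2 T', strict_toward T' & forall z, T' z = z ->
    T z = z /\ forall k, k \in s -> Q k z = z.
Proof.
move=> Tst; elim: s => [|k s IHs] Qs; first by exists T.
have [|T' T'st T'fix] := IHs; first by move=> l ls; apply: Qs; rewrite inE ls orbT.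
have [Qnf Qst] := Qs k (mem_head _ _).
have [|st fix_] := strict_toward_comp T'st Qnf.
  by move=> z /T'fix[Tz _]; exact: Qst.
exists (Q k \o T') => // z /fix_[/T'fix[Tz Qz] Qkz]; split=> // l.
by rewrite inE => /predU1P[->|/Qz].
Qed.

(* The iterates of T have a cluster point z.  The distances of the iterates to a
   point of F decrease, so T does not change the distance from z to any point of
   F, whence z is fixed, lies in F, and is the limit of the iterates. *)
Lemma strict_toward_iter_cvg T x : strict_toward T -> (exists c, F c) ->
  (forall z, T z = z -> F z) ->
  exists z, F z /\ forall e, 0 < e -> exists N, forall m, (N <= m)%N ->
    l1norm (iter m T x - z) < e.
Proof.
move=> [Tnf Tst] [c0 Fc0] fixF; pose u m := iter m T x.
have mono c m k : F c -> (m <= k)%N -> l1norm (u k - c) <= l1norm (u m - c).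
  move=> Fc /subnK<-; elim: (k - m)%N => [//|l IHl].
  by rewrite addSn /=; apply: le_trans IHl; exact: nonexpansive_fixing_dist.
have [z zP] : exists z, forall e, 0 < e -> forall N, exists2 k,
    (N <= k)%N & l1norm (u k - z) < e.
  apply: (@bounded_cluster _ _ _ (l1norm (x - c0) + l1norm c0)) => k.
  rewrite -[u k](subrK c0); apply: (le_trans (l1normD _ _)).
  by rewrite lerD2r; exact: (mono c0 0%N k).
have Fz : F z.
  apply/fixF/Tst => c Fc; apply/ler_addgt0Pr => e e0.
  have e2 : 0 < e / 2 by lra.
  have [m _ mz] := zP _ e2 0%N; have [k mk kz] := zP _ e2 m.+1.
  have := l1dist_triangle (u k) z c; rewrite (l1distC z (u k)).
  have := mono c _ _ Fc mk; have := l1dist_triangle (T z) (u m.+1) c.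
  have := proj1 Tnf (u m) z; rewrite /= -/(u m); lra.
exists z; split=> // e e0; have [N _ Nz] := zP e e0 0%N.
by exists N => m Nm; apply: le_lt_trans Nz; exact: mono.
Qed.

Lemma strict_toward_contractive T : strict_toward T -> (exists c, F c) ->
  (forall z, T z = z -> F z) -> contractive_set F.
Proof.
move=> Tst exF fixF; split=> //.
have [P PP] := choice (fun x => strict_toward_iter_cvg x Tst exF fixF).
have [[Tn Tf] _] := Tst.
exists P; split; [|split] => [x|x Fx|x y]; first by case: (PP x).
  apply/esym/subr0_eq/l1norm_eq0/ler_addgt0Pr => e e0; rewrite add0r.
  have [_ /(_ e e0)[N /(_ N (leqnn N))]] := PP x.
  suff -> : iter N T x = x by move/ltW.
  by elim: N => //= N ->; exact: Tf.
apply/ler_addgt0Pr => e e0; have e2 : 0 < e / 2 by lra.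
have [_ /(_ _ e2)[N xN]] := PP x; have [_ /(_ _ e2)[M yM]] := PP y.
have := xN (N + M)%N (leq_addr _ _); have := yM (N + M)%N (leq_addl _ _).
move: (N + M)%N => m ym xm.
have : l1norm (iter m T x - iter m T y) <= l1norm (x - y).
  by elim: m {xm ym} => //= m; apply: le_trans.
have := l1dist_triangle (iter m T x) (P x) (P y).
have := l1dist_triangle (iter m T y) (iter m T x) (P y).
by rewrite (l1distC (P x) (iter m T x)); lra.
Qed.

End Retraction.

(** * Pushing a point towards F along one or two coordinates *)

Section Push.
Variables (R : realType) (n : nat) (F : 'rV[R]_n -> Prop).
Implicit Types (x y z c : 'rV[R]_n) (i j l : 'I_n) (t e : R).

(** Going from [y] to [x] one coordinate at a time has total l1 length exactly [l1norm (x - y)]. *)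
Lemma nonexpansive_coord (Q : 'rV[R]_n -> 'rV[R]_n) :
  (forall x l t, l1norm (Q (x + t *: delta_mx ord0 l) - Q x) <= `|t|) ->
  forall x y, l1norm (Q x - Q y) <= l1norm (x - y).
Proof.
move=> Qstep x y; pose w := x - y.
have -> : x = y + w by rewrite addrC subrK.
rewrite [y + w - y]addrC addKr {1}(row_sum_delta w) [leRHS]/l1norm.
elim/big_rec2: _ => [|l t v _ vt]; first by rewrite addr0 subrr l1norm0.
apply: le_trans (l1dist_triangle (Q (y + v)) _ _) _; apply: lerD vt.
by rewrite addrCA addrC; exact: Qstep.
Qed.

Lemma sign_or (s : R) : `|s| = 1 -> s = 1 \/ s = -1.
Proof. by move/eqP; rewrite eqr_norml ler01 andbT => /orP[]/eqP; [left|right]. Qed.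

(** The two bounds place [d] between 0 and [s * t]. *)
Lemma sign_step (s t d : R) : `|s| = 1 -> d <= Num.max 0 (s * t) ->
  - d <= Num.max 0 (s * - t) -> `|t - d * s| + `|d| <= `|t|.
Proof.
move=> /sign_or[]->; rewrite ?mul1r ?mulN1r ?opprK ?mulr1 ?mulrN1 ?opprK !le_max.
  by move=> /orP[] ? /orP[] ?; case: (ler0P t); case: (ler0P d);
    case: (ler0P (t - d)); lra.
by move=> /orP[] ? /orP[] ?; case: (ler0P t); case: (ler0P d);
  case: (ler0P (t + d)); lra.
Qed.

(* [push i j s1 s2 z] is z moved in the direction - (s1 e_i + s2 e_j) until it
   lies in the closure of F + {y : s1 y_i <= 0, s2 y_j <= 0}. *)
Definition excess i j (s1 s2 : R) x c : R :=
  Num.max 0 (Num.max (s1 * (x ord0 i - c ord0 i)) (s2 * (x ord0 j - c ord0 j))).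

(** For signs [s1], [s2] and [i != j], the excess over [c] is the least [t >= 0] with
    [x - t (s1 e_i + s2 e_j)] in [c + {y : s1 y_i <= 0, s2 y_j <= 0}]; the infimum over [F] tells
    how far to push. *)
Definition depth i j (s1 s2 : R) x : R :=
  inf [set t | exists2 c, F c & t = excess i j s1 s2 x c]%classic.

Definition push i j (s1 s2 : R) x : 'rV[R]_n :=
  x - depth i j s1 s2 x *: (s1 *: delta_mx ord0 i + s2 *: delta_mx ord0 j).

Hypothesis F0 : exists c, F c.

Section Fixed.
Variables (i j : 'I_n) (s1 s2 : R).
Hypotheses (s1E : `|s1| = 1) (s2E : s2 = 0 \/ i != j /\ `|s2| = 1).
Local Notation excess := (excess i j s1 s2).
Local Notation depth := (depth i j s1 s2).
Local Notation push := (push i j s1 s2).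

Lemma excess_le t x c : (excess x c <= t) = [&& 0 <= t,
  s1 * (x ord0 i - c ord0 i) <= t & s2 * (x ord0 j - c ord0 j) <= t].
Proof. by rewrite !ge_max. Qed.

Lemma excess_lt t x c : (excess x c < t) = [&& 0 < t,
  s1 * (x ord0 i - c ord0 i) < t & s2 * (x ord0 j - c ord0 j) < t].
Proof. by rewrite !gt_max. Qed.

Lemma depth_le x c : F c -> depth x <= excess x c.
Proof.
move=> Fc; apply: ge_inf; last by exists c.
by exists 0 => _ [d _ ->]; rewrite le_max lexx.
Qed.

Lemma le_depth t x : (forall c, F c -> t <= excess x c) -> t <= depth x.
Proof.
move=> xt; apply: lb_le_inf; first by case: F0 => c Fc; exists (excess x c), c.
by move=> _ [c Fc ->]; exact: xt.
Qed.

Lemma depth_ge0 x : 0 <= depth x.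
Proof. by apply: le_depth => c _; rewrite le_max lexx. Qed.

Lemma depth_eq0 c : F c -> depth c = 0.
Proof.
move=> Fc; apply/eqP; rewrite eq_le depth_ge0 andbT; apply: le_trans (depth_le c Fc) _.
by rewrite excess_le !subrr !mulr0 lexx.
Qed.

Lemma depth_shift t x y : 0 <= t -> s1 * (y ord0 i - x ord0 i) <= t ->
  s2 * (y ord0 j - x ord0 j) <= t -> depth y <= depth x + t.
Proof.
move=> t0 t1 t2; rewrite -lerBlDr; apply: le_depth => c Fc.
rewrite lerBlDr; apply: le_trans (depth_le y Fc) _.
have := lexx (excess x c); rewrite (excess_le (excess x c)) => /and3P[e0 e1 e2].
by rewrite excess_le; apply/and3P; split; lra.
Qed.

Lemma depth_lt t x : depth x < t -> exists2 c, F c & excess x c < t.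
Proof.
move=> xt; apply: contrapT => nc; move: xt; rewrite ltNge => /negP; apply.
by apply: le_depth => c Fc; rewrite leNgt; apply/negP => ct; apply: nc; exists c.
Qed.

(** A step [t] in coordinate [i] or [j] changes the depth by some [D] between 0 and the signed step;
    the push takes [|D|] off that coordinate and adds at most [|D|] to the other. *)
Lemma push_nonexpansive x y : l1norm (push x - push y) <= l1norm (x - y).
Proof.
apply: nonexpansive_coord => {}x l t; set y' := x + t *: delta_mx ord0 l.
have y'E k : y' ord0 k - x ord0 k = if k == l then t else 0.
  by rewrite /y' !mxE eqxx /=; case: eqP => _; rewrite /= ?mulr1 ?mulr0 addrC addKr.
set D := depth y' - depth x.
have -> : push y' - push x = t *: delta_mx ord0 l
    - ((D * s1) *: delta_mx ord0 i + (D * s2) *: delta_mx ord0 j).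
  by apply/rowP => k; rewrite /push /D /y' !mxE; ring.
have s2le : `|s2| <= 1 by case: s2E => [->|[_ ->]] //; rewrite normr0.
have yxE k : x ord0 k - y' ord0 k = if k == l then - t else 0.
  by rewrite -opprB y'E; case: eqP; rewrite ?oppr0.
have up e : 0 <= e -> s1 * (if i == l then t else 0) <= e ->
    s2 * (if j == l then t else 0) <= e -> D <= e.
  by move=> e0; rewrite -!y'E => e1 e2; rewrite /D lerBlDl; exact: depth_shift.
have dn e : 0 <= e -> s1 * (if i == l then - t else 0) <= e ->
    s2 * (if j == l then - t else 0) <= e -> - D <= e.
  by move=> e0; rewrite -!yxE => e1 e2; rewrite /D opprB lerBlDl; exact: depth_shift.
have m0 (a : R) : 0 <= Num.max 0 a by rewrite le_max lexx.
have ma (a : R) : a <= Num.max 0 a by rewrite le_max lexx orbT.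
have [il|il] := eqVneq i l.
  have step : `|t - D * s1| + `|D| <= `|t|.
    have s2l a : s2 * (if j == l then a else 0) = 0.
      case: s2E => [->|[ij _]]; first by rewrite mul0r.
      by rewrite -il eq_sym (negPf ij) mulr0.
    by apply: sign_step => //; [apply: up|apply: dn]; rewrite ?s2l // il eqxx.
  apply: le_trans step; rewrite -il opprD addrA -scalerBl.
  apply: (le_trans (l1normD _ _)); rewrite l1normN !l1norm_delta lerD2l normrM.
  by rewrite ler_piMr.
have [jl|jl] := eqVneq j l; last first.
  have -> : D = 0.
    apply/eqP; rewrite eq_le -[0 <= D]oppr_le0.
    by rewrite up ?dn // ?(negPf il) ?(negPf jl) mulr0.
  by rewrite !mul0r !scale0r addr0 subr0 l1norm_delta.
case: s2E => [s20|[_ s21]].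
  have -> : D = 0.
    apply/eqP; rewrite eq_le -[0 <= D]oppr_le0.
    by rewrite up ?dn // ?(negPf il) ?mulr0 // s20 mul0r.
  by rewrite !mul0r !scale0r addr0 subr0 l1norm_delta.
have step : `|t - D * s2| + `|D| <= `|t|.
  by apply: sign_step => //; [apply: up|apply: dn]; rewrite ?(negPf il) ?mulr0 // jl eqxx.
apply: le_trans step; rewrite -jl [X in _ - X]addrC opprD addrA -scalerBl.
apply: (le_trans (l1normD _ _)); rewrite l1normN !l1norm_delta lerD2l normrM.
by rewrite s1E mulr1.
Qed.

Lemma push_fixing c : F c -> push c = c.
Proof. by move=> Fc; rewrite /Push.push depth_eq0 // scale0r subr0. Qed.

Lemma push_nonexpansive_fixing : nonexpansive_fixing F push.
Proof. by split; [exact: push_nonexpansive | exact: push_fixing]. Qed.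

Lemma push_eq x : depth x = 0 -> push x = x.
Proof. by rewrite /push => ->; rewrite scale0r subr0. Qed.

Lemma eq_push_depth x : push x = x -> depth x = 0.
Proof.
move=> /(congr1 (fun y : 'rV[R]_n => y ord0 i)) /eqP; rewrite !mxE !eqxx /=.
rewrite -[eqbRHS]addr0 (inj_eq (addrI _)) oppr_eq0 mulr1 mulf_eq0 => /orP[/eqP//|].
have [->|[ij _]] := s2E; rewrite ?mul0r ?(negPf ij) ?mulr0 addr0 => /eqP s10.
  by move: s1E; rewrite s10 normr0 => /esym/eqP; rewrite oner_eq0.
by move: s1E; rewrite s10 normr0 => /esym/eqP; rewrite oner_eq0.
Qed.

(** A positive depth is at most [s1 * (z_i - c_i)] for every [c] in [F], so the push moves [z_i]
    towards [c_i] without overshooting. *)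
Lemma stalls_push_single z : s2 = 0 -> stalls F push z -> push z = z.
Proof.
move=> s20 zst; apply: push_eq; apply/eqP; rewrite eq_le depth_ge0 andbT leNgt.
apply/negP; have [c Fc] := F0; move: (zst c Fc) (depth_le z Fc).
rewrite /Push.push /Push.excess; set t := depth z => yt.
rewrite s20 mul0r !le_max => /or3P[?|s1t|?] t0; try lra.
move: yt; rewrite /l1norm (bigD1 i) //= [leRHS](bigD1 i) //=.
rewrite [X in _ <= _ + X](eq_bigr (fun k => `|(z - c) ord0 k|)); last first.
  by move=> k ki; rewrite s20 !mxE (negPf ki) andbF /= !(mulr0, mul0r, addr0, subr0).
rewrite lerD2r s20 !mxE !eqxx /= mulr1 mul0r addr0.
by have [] := sign_or s1E => s1i; move: s1t; rewrite s1i;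
  case: (ler0P (z ord0 i - c ord0 i)); case: (ler0P (z ord0 i - _ - c ord0 i)); lra.
Qed.

(* A stalled push separates F into the points below z by the depth t in the
   direction of i but not below z in that of j, and vice versa.  If z is in the
   bounding box of F, both sorts of points exist, and a segment that joins them
   meets neither sort. *)
Lemma stalls_push_pair z : convex_set F -> i != j -> `|s2| = 1 ->
  (forall e, 0 < e -> exists2 c, F c & s1 * (z ord0 i - c ord0 i) < e) ->
  (forall e, 0 < e -> exists2 c, F c & s2 * (z ord0 j - c ord0 j) < e) ->
  stalls F push z -> push z = z.
Proof.
move=> cF ij s21 box1 box2 zst; apply: push_eq; apply/eqP.
rewrite eq_le depth_ge0 andbT leNgt; apply/negP => t0.
set t := depth z in t0.
pose p c := s1 * (z ord0 i - c ord0 i); pose q c := s2 * (z ord0 j - c ord0 j).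
have dich c : F c -> (t <= p c /\ q c <= 0) \/ (t <= q c /\ p c <= 0).
  move=> Fc; have pq : t <= p c \/ t <= q c.
    have := depth_le z Fc; rewrite /Push.excess !le_max -/t.
    by move=> /or3P[t0'|?|?]; [lra|left|right].
  (* Stalling, reduced to the coordinates [i] and [j]. If [p c >= t], this forces [q c <= 0], and
     likewise with [p] and [q] exchanged. *)
  have : `|p c| + `|q c| <= `|p c - t| + `|q c - t|.
    have sE (s a : R) : `|s| = 1 -> `|s * a - t| = `|a - t * s|.
      move=> sn; rewrite -[RHS]mul1r -sn -normrM mulrBr; congr (`|_ - _|).
      by case: (sign_or sn) => ->; ring.
    rewrite /p /q !normrM s1E s21 !mul1r !sE //.
    have zc := zst c Fc; move: zc; rewrite /Push.push /l1norm -/t => zc.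
    rewrite (bigD1 i) //= (bigD1 j) 1?eq_sym //= in zc.
    rewrite [leRHS](bigD1 i) //= [X in _ <= _ + X](bigD1 j) 1?eq_sym //= in zc.
    rewrite [X in _ <= _ + (_ + X)](eq_bigr (fun k => `|(z - c) ord0 k|)) in zc; last first.
      move=> k /andP[ki kj].
      by rewrite !mxE (negPf ki) (negPf kj) /= !(mulr0, addr0, subr0).
    move: zc; rewrite !addrA lerD2r !mxE !eqxx (negPf ij) eq_sym (negPf ij) /=.
    by rewrite !mulr1 !mulr0 addr0 add0r ![_ - _ - c _ _]addrAC.
  by case: pq; case: (ler0P (p c)); case: (ler0P (q c)); case: (ler0P (p c - t));
    case: (ler0P (q c - t)); lra.
have [c Fc ct] := box1 t t0; have [c' Fc' ct'] := box2 t t0.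
have [[]|[qc pc]] := dich c Fc; first by rewrite /p; lra.
have [[pc' qc']|[]] := dich c' Fc'; last by rewrite /q; lra.
(* Makes [p] equal to [t / 2] at the combination, which neither alternative of [dich] allows. *)
set k := (p c' - t / 2) / (p c' - p c).
have d0 : 0 < p c' - p c by lra.
have kE : k * (p c' - p c) = p c' - t / 2 by rewrite /k; field; lra.
have k0 : 0 <= k by rewrite divr_ge0 //; lra.
have k1 : k <= 1 by rewrite ler_pdivrMr //; lra.
have := dich _ (cF c c' k Fc Fc' k0 k1).
have -> : p (k *: c + (1 - k) *: c') = t / 2.
  transitivity (p c' - k * (p c' - p c)); last by rewrite kE; ring.
  by rewrite /p !mxE; ring.
lra.
Qed.

End Fixed.

End Push.

(** * The equivalences and countable families of half-spaces *)

Section Characterization.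
Variables (R : realType) (n : nat).
Implicit Types (x y z c v : 'rV[R]_n) (F : 'rV[R]_n -> Prop).

Lemma mulr_sign_le (g e w : R) : (-1) ^+ (g < 0)%R * w < e -> g * w <= `|g| * e.
Proof.
move=> we; rewrite {1}[g]realEsign ?num_real // mulrAC mulrC.
by rewrite ler_wpM2l // ltW.
Qed.

(** Single-coordinate pushes come first: their common fixed points lie in the closed bounding box of
    [F], as the pair pushes require. At a fixed point outside [F], the coefficient signs of a
    separating functional select a push of depth 0, hence points of [F] that contradict the
    separation. *)
Lemma two_coord_separated_contractive F : convex_set F -> (exists c, F c) ->
  two_coord_separated F -> contractive_set F.
Proof.
move=> cF F0 sepF.
pose S (k : 'I_n * bool) := push F k.1 k.1 ((-1) ^+ k.2) 0.
have sgn (b : bool) : `|(-1) ^+ b| = 1 :> R by rewrite normr_sign.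
have zero (i : 'I_n) : (0 : R) = 0 \/ i != i /\ `|0 : R| = 1 by left.
have idst : strict_toward F id by [].
have [|T1 T1st T1fix] :=
    @strict_toward_seq _ _ _ _ S _ (enum {: 'I_n * bool}) idst.
  move=> k _; split; first exact: push_nonexpansive_fixing.
  by move=> z _; exact: stalls_push_single.
have box z : T1 z = z -> forall i (b : bool) e, 0 < e ->
    exists2 c, F c & (-1) ^+ b * (z ord0 i - c ord0 i) < e.
  move=> /T1fix[_ Sz] i b e e0.
  have /eq_push_depth dz := Sz (i, b) (mem_enum _ _).
  have [|c Fc] := @depth_lt _ _ F F0 i i ((-1) ^+ b) 0 e z; first by rewrite dz.
  by rewrite excess_lt => /and3P[_ ? _]; exists c.
pose Q (k : 'I_n * 'I_n * (bool * bool)) :=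
  push F k.1.1 k.1.2 ((-1) ^+ k.2.1) ((-1) ^+ k.2.2).
have [|T2 T2st T2fix] := @strict_toward_seq _ _ _ _ Q _
    [seq k <- enum {: 'I_n * 'I_n * (bool * bool)} | k.1.1 != k.1.2] T1st.
  move=> k; rewrite mem_filter => /andP[kd _].
  have dist : (-1) ^+ k.2.2 = 0 :> R \/ k.1.1 != k.1.2 /\ `|(-1) ^+ k.2.2| = 1 :> R.
    by right.
  split; first exact: push_nonexpansive_fixing.
  by move=> z /box bz; apply: stalls_push_pair => //; exact: bz.
apply: (strict_toward_contractive T2st F0) => z /T2fix[/box bz Qz].
apply: contrapT => /sepF[i [j [a [b [t [abF abz]]]]]].
(* Pair pushes have distinct indices; a functional of one coordinate is handled by the box. *)
have [ij|ij] := eqVneq i j.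
  subst j; rewrite -mulrDl in abz; set g := a + b in abz.
  have g0 := normr_ge0 g; set e := (g * z ord0 i - t) / (`|g| + 1).
  have eE : e * (`|g| + 1) = g * z ord0 i - t by rewrite /e; field; lra.
  have e0 : 0 < e by rewrite divr_gt0 //; lra.
  have [c Fc /mulr_sign_le ce] := bz i (g < 0) _ e0.
  by have := abF c Fc; rewrite -mulrDl -/g; lra.
have a0 := normr_ge0 a; have b0 := normr_ge0 b.
set g := a * z ord0 i + b * z ord0 j - t; set e := g / (`|a| + `|b| + 1).
have eE : e * (`|a| + `|b| + 1) = g by rewrite /e; field; lra.
have e0 : 0 < e by rewrite divr_gt0 /g //; lra.
have kQ : (i, j, (a < 0, b < 0)) \in
    [seq k <- enum {: 'I_n * 'I_n * (bool * bool)} | k.1.1 != k.1.2].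
  by rewrite mem_filter /= ij mem_enum.
have dist : (-1) ^+ (b < 0)%R = 0 :> R \/ i != j /\ `|(-1) ^+ (b < 0)%R| = 1 :> R.
  by right.
have dz := eq_push_depth (sgn _) dist (Qz _ kQ).
have [|c Fc] := @depth_lt _ _ F F0 i j ((-1) ^+ (a < 0)%R) ((-1) ^+ (b < 0)%R) e z.
  by rewrite dz.
rewrite excess_lt => /and3P[_ /mulr_sign_le ae /mulr_sign_le be].
by have := abF c Fc; rewrite /g in eE; lra.
Qed.

Lemma lin_functional_dot (f : 'rV[R]_n -> R) : lin_functional f ->
  exists v, forall x, f x = dot v x.
Proof.
move=> fl; exists (\row_l f (delta_mx ord0 l)) => x.
have f0 : f 0 = 0.
  have := fl 1 0 0; rewrite scaler0 addr0 mul1r => /eqP.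
  by rewrite -subr_eq0 opprD addNKr oppr_eq0 => /eqP.
rewrite {1}(row_sum_delta x) /dot.
elim/big_rec2: _ => [//|l t y _ <-]; by rewrite fl mxE mulrC.
Qed.

Lemma contractive_existence F : contractive_set F -> existence_set F.
Proof.
move=> [_ [P [PF [PfixF Pn]]]] x; exists (P x); split=> [|c Fc]; first exact: PF.
by rewrite -{1}(PfixF c Fc).
Qed.

(** The ball centred at [z - v] touches the boundary hyperplane at [z] from inside [H], so the
    normal [v] of [H] has at most two nonzero coordinates. *)
Lemma contractive_half_space_separated (H : 'rV[R]_n -> Prop) : (0 < n)%N ->
  contractive_half_space H -> two_coord_separated H.
Proof.
move=> n0 [[f [d [/lin_functional_dot[v fv] [[x1 fx1] HE]]]] /contractive_existence exH].
have v0 : 0 < dot v v.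
  apply: dot_gt0; apply: contra fx1 => /eqP v0.
  by rewrite fv v0 /dot big1 // => i _; rewrite mxE mul0r.
pose z := (d / dot v v) *: v.
have vz : dot v z = d by rewrite /z dotZr; field; lra.
have [i [j [a [b vE]]]] : exists i j (a b : R),
    forall y, dot v y = a * y ord0 i + b * y ord0 j.
  apply: dot_two_coords => // i j k.
  apply: (@touching_normal_support _ _ H z) => // [c /HE|y yz].
    by rewrite fv vz.
  apply/HE; rewrite fv -vz; have := dot_ge0 (v - (y - (z - v))).
  move: yz; set w := y - (z - v); have -> : y = w + z - v.
    by rewrite /w; apply/rowP => l; rewrite !mxE; ring.
  by clearbody w z; rewrite !dotE (dotC w v); lra.
move=> x nHx; exists i, j, a, b, d; split=> [c /HE|]; first by rewrite fv vE.
by rewrite -vE -fv ltNge; apply/negP => /HE.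
Qed.

Lemma two_coord_half_space_contractive (i j : 'I_n) (a b d : R) x :
  a * x ord0 i + b * x ord0 j != 0 ->
  contractive_half_space (fun y => a * y ord0 i + b * y ord0 j <= d).
Proof.
move=> fx; split.
  exists (fun y => a * y ord0 i + b * y ord0 j), d; split; last by split=> //; exists x.
  by move=> t y y'; rewrite !mxE; ring.
apply: two_coord_separated_contractive.
- move=> y y' t yd y'd t0 t1; rewrite !mxE.
  have : t * (a * y ord0 i + b * y ord0 j) <= t * d by rewrite ler_wpM2l.
  have : (1 - t) * (a * y' ord0 i + b * y' ord0 j) <= (1 - t) * d.
    by rewrite ler_wpM2l ?subr_ge0.
  lra.
- exists ((d / (a * x ord0 i + b * x ord0 j)) *: x); rewrite !mxE.
  by rewrite le_eqVlt; apply/orP; left; apply/eqP; field.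
by move=> y /negP; rewrite -ltNge => yd; exists i, j, a, b, d.
Qed.

Lemma countable_inter_separated F : (0 < n)%N ->
  countable_inter_contractive_half_spaces F -> two_coord_separated F.
Proof.
move=> n0 [H [Hc FH]] x nFx.
have [k nHx] : exists k, ~ H k x.
  by apply: contrapT => nk; apply/nFx/FH => k; apply: contrapT => nH; apply: nk; exists k.
have [i [j [a [b [t [Ht tx]]]]]] := contractive_half_space_separated n0 (Hc k) nHx.
by exists i, j, a, b, t; split=> // c /FH /(_ k); exact: Ht.
Qed.

(** On a bounded set containing [F] and [x], small changes of the coefficients change the functional
    uniformly little. *)
Lemma rational_separation F x (i j : 'I_n) (a b t : R) : bounded_set F ->
  (exists c, F c) -> (forall c, F c -> a * c ord0 i + b * c ord0 j <= t) ->
  t < a * x ord0 i + b * x ord0 j ->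
  exists a' b' t' : rat,
    (forall c, F c -> ratr a' * c ord0 i + ratr b' * c ord0 j <= ratr t') /\
    ratr t' < ratr a' * x ord0 i + ratr b' * x ord0 j.
Proof.
move=> [M FM] [c0 Fc0] abF abx; set g := a * x ord0 i + b * x ord0 j - t.
have g0 : 0 < g by rewrite /g; lra.
set N := M + l1norm x + 1.
have M0 : 0 <= M by exact: le_trans (l1norm_ge0 c0) (FM c0 Fc0).
have N0 : 0 < N by rewrite /N; have := l1norm_ge0 x; lra.
(* Each coefficient contributes an error of at most [e * N = g / 8], which leaves room for [t']
   between [t + g / 4] and [t + 3 g / 4]. *)
pose e := g / (8 * N); have e0 : 0 < e by rewrite divr_gt0 // mulr_gt0.
have eN : e * N = g / 8 by rewrite /e; field; lra.
have near (r : R) : exists q : rat, `|ratr q - r| <= e.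
  have [|q] := @rat_in_itvoo R r (r + e); first by lra.
  by rewrite in_itv /= => /andP[? ?]; exists q; rewrite ler_norml; lra.
have [a' aa'] := near a; have [b' bb'] := near b.
have close y : l1norm y <= N ->
    `|ratr a' * y ord0 i + ratr b' * y ord0 j - (a * y ord0 i + b * y ord0 j)|
      <= g / 4.
  move=> yN; have -> : ratr a' * y ord0 i + ratr b' * y ord0 j
      - (a * y ord0 i + b * y ord0 j)
    = (ratr a' - a) * y ord0 i + (ratr b' - b) * y ord0 j by ring.
  have bd (r : R) l : `|r| <= e -> `|r * y ord0 l| <= e * N.
    move=> re; rewrite normrM ler_pM //.
    by apply: le_trans yN; exact: coord_le_l1norm.
  apply: (le_trans (ler_normD _ _)).
  by have := bd _ i aa'; have := bd _ j bb'; rewrite eN; lra.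
have [|t' ] := @rat_in_itvoo R (t + g / 4) (t + g * 3 / 4); first by lra.
rewrite in_itv /= => /andP[tt' t't].
exists a', b', t'; split=> [c Fc|].
  have : l1norm c <= N by rewrite /N; have := FM c Fc; have := l1norm_ge0 x; lra.
  by move=> /close; rewrite ler_norml => /andP[_]; have := abF c Fc; lra.
have : l1norm x <= N by rewrite /N; lra.
by move=> /close; rewrite ler_norml => /andP[+ _]; rewrite /g in tt' t't *; lra.
Qed.

(** The family consists of all half-spaces containing [F] that are given by a nonzero rational
    two-coordinate functional and a rational bound. *)
Lemma separated_countable_inter F : (0 < n)%N -> bounded_set F ->
  (exists c, F c) -> two_coord_separated F ->
  countable_inter_contractive_half_spaces F.
Proof.
move=> n0 bF F0 sepF.
pose I := ('I_n * 'I_n * (rat * rat * rat))%type.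
pose f (k : I) x : R := ratr k.2.1.1 * x ord0 k.1.1 + ratr k.2.1.2 * x ord0 k.1.2.
pose valid (k : I) := (forall c, F c -> f k c <= ratr k.2.2) /\ exists x, f k x != 0.
(* A default member: [x_i <= q] with [q] above a norm bound of [F]. *)
have [k0 k0v] : exists k0, valid k0.
  have [M FM] := bF; pose i := Ordinal n0.
  have [|q] := @rat_in_itvoo R M (M + 1); first by lra.
  rewrite in_itv /= => /andP[Mq _]; exists (i, i, (1, 0, q)); split.
    move=> c Fc; rewrite /f /= rmorph1 rmorph0 mul1r mul0r addr0.
    apply: le_trans (ltW Mq); apply: le_trans (FM c Fc).
    by apply: le_trans (ler_norm _) _; exact: coord_le_l1norm.
  exists (delta_mx ord0 i); rewrite /f /= rmorph1 rmorph0 mul1r mul0r addr0.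
  by rewrite mxE !eqxx oner_neq0.
(* Numbers that code no index or an invalid one are sent to [k0]. *)
pose k m := let k := odflt k0 (unpickle m) in if `[< valid k >] then k else k0.
have kv m : valid (k m) by rewrite /k; case: asboolP.
exists (fun m x => f (k m) x <= ratr (k m).2.2); split=> [m|x].
  by have [_ [x fx]] := kv m; exact: two_coord_half_space_contractive fx.
split=> [Fx m|Hx]; first exact: (proj1 (kv m)).
apply: contrapT => /sepF[i [j [a [b [t [abF abx]]]]]].
have [a' [b' [t' [F' x']]]] := rational_separation bF F0 abF abx.
pose l : I := (i, j, (a', b', t')).
(* A functional that separates [x] from a point of [F] is not identically 0. *)
have lv : valid l.
  split=> //; apply: contrapT => nl; have fl0 y : f l y = 0.
    by apply/eqP; apply: contrapT => fy; apply: nl; exists y; apply/negP.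
  have [c Fc] := F0; have := F' c Fc; move: x'.
  by rewrite -[_ + _]/(f l x) -[X in _ -> X <= _ -> _]/(f l c) !fl0; lra.
have := Hx (pickle l); rewrite /k pickleK /=; case: asboolP => // _.
by rewrite leNgt x'.
Qed.

End Characterization.

Theorem theorem20 (R : realType) (n : nat) (hn : (0 < n)%N)
  (F : 'rV[R]_n -> Prop) :
  convex_set F -> bounded_set F -> nonempty_interior F ->
  (existence_set F <-> contractive_set F) /\
  (contractive_set F <-> countable_inter_contractive_half_spaces F).
Proof.
move=> cF bF intF.
have F0 : exists c, F c.
  by have [p [r [r0 pF]]] := intF; exists p; apply: pF; rewrite subrr l1norm0.
have sep_contr : two_coord_separated F -> contractive_set F.
  exact: two_coord_separated_contractive.
have exist_sep : existence_set F -> two_coord_separated F.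
  exact: existence_two_coord_separated.
split; split.
- by move/exist_sep/sep_contr.
- exact: contractive_existence.
- by move/contractive_existence/exist_sep; exact: separated_countable_inter.
- by move/(countable_inter_separated hn)/sep_contr.
Qed.
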